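(* Let $k$ be a field that is not algebraic over a finite subfield. Let $R$ be a $k$-algebra with at least one nonartinian primitive subquotient. Then $R$ contains a free subsemigroup.
   Context: All rings, algebras, subrings and subalgebras are associative and unital. A subquotient of a $k$-algebra $R$ is an algebra of the form $A/I$, where $A$ is a $k$-subalgebra of $R$ and $I$ is a two-sided ideal of $A$. A ring is primitive if it has a faithful simple module (on the left or on the right); for a primitive ring, being left artinian and being right artinian are equivalent, and ''nonartinian'' means that this condition fails. ''Free subsemigroup'' always means a multiplicative, noncyclic free subsemigroup: $R$ contains a free subsemigroup if there exist $x,y\in R$ such that the subsemigroup of $(R,\cdot)$ generated by $x$ and $y$ is free on $x,y$ (distinct nonempty words in $x,y$ give distinct elements of $R$). *)

(* Defs.v *)
From HB Require Import structures.
From mathcomp Require Import all_boot all_order all_algebra.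

Set Implicit Arguments.
Unset Strict Implicit.
Unset Printing Implicit Defensive.

Import GRing.Theory.

Local Open Scope ring_scope.
Local Open Scope quotient_scope.

(* Subsets are boolean predicates, as everywhere in MathComp; in the classical
   setting these are all the subsets. *)

Definition algebraic_over_finite_subfield (k : fieldType) : Prop :=
  exists F : {pred k},
    [/\ divring_closed F,
        exists s : seq k, {subset F <= s}
      & forall x : k, exists p : {poly k},
          [/\ p \is a polyOver F, p != 0 & root p x]].

Section Subalgebra.

Variables (k : fieldType) (R : algType k) (A : subalgClosed R).

Record subalgebra := Subalgebra {subalgebra_val : R; _ : subalgebra_val \in A}.

HB.instance Definition _ := [isSub for subalgebra_val].
HB.instance Definition _ := [Choice of subalgebra by <:].
HB.instance Definition _ := [SubChoice_isSubAlgebra of subalgebra by <:].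

End Subalgebra.

HB.mixin Record isTwoSidedIdeal (A : pzRingType) (I : A -> bool) := {
  ideal_mull : forall a : A, {in I, forall x, a * x \in I};
  ideal_mulr : forall a : A, {in I, forall x, x * a \in I}
}.

#[short(type="twoSidedIdeal")]
HB.structure Definition TwoSidedIdeal (A : pzRingType) :=
  {I of GRing.ZmodClosed A I & isTwoSidedIdeal A I}.

(* MathComp only puts a ring structure on the quotient of a commutative ring by
   a proper ideal. Here A need not be commutative and I may be all of A, in which
   case the quotient is the zero ring. *)
Section QuotientRing.

Variables (A : pzRingType) (I : twoSidedIdeal A).

Definition quotient_ring : Type := Quotient.quot I.
Local Notation Q := quotient_ring.

HB.instance Definition _ := GRing.Zmodule.on Q.
HB.instance Definition _ : EqQuotient A (Quotient.equiv I) Q :=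
  EqQuotient.on Q.
HB.instance Definition _ : isZmodQuotient A (Quotient.equiv I) 0 -%R +%R Q :=
  ZmodQuotient.on Q.

Definition quotient_one : Q := lift_cst Q 1.
Definition quotient_mul : Q -> Q -> Q := lift_op2 Q *%R.

Canonical pi_quotient_one := PiConst quotient_one.

Lemma pi_quotient_mulM : {morph \pi_Q : x y / x * y >-> quotient_mul x y}.
Proof.
move=> x y; unlock quotient_mul; apply/eqP; rewrite piE Quotient.equivE.
set x' := repr _; set y' := repr _.
have Ix : x - x' \in I by rewrite Quotient.idealrBE reprK.
have Iy : y - y' \in I by rewrite Quotient.idealrBE reprK.
have -> : x * y - x' * y' = (x - x') * y + x' * (y - y').
  by rewrite mulrBl mulrBr addrA subrK.
by apply: rpredD; [apply: ideal_mulr | apply: ideal_mull].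
Qed.
Canonical pi_quotient_mul := PiMorph2 pi_quotient_mulM.

Fact quotient_mulA : associative quotient_mul.
Proof.
by move=> x y z; rewrite -[x]reprK -[y]reprK -[z]reprK !piE mulrA.
Qed.

Fact quotient_mul1 : left_id quotient_one quotient_mul.
Proof. by move=> x; rewrite -[x]reprK !piE mul1r. Qed.

Fact quotient_mulr1 : right_id quotient_one quotient_mul.
Proof. by move=> x; rewrite -[x]reprK !piE mulr1. Qed.

Fact quotient_mulDl : left_distributive quotient_mul +%R.
Proof.
by move=> x y z; rewrite -[x]reprK -[y]reprK -[z]reprK !piE mulrDl.
Qed.

Fact quotient_mulDr : right_distributive quotient_mul +%R.
Proof.
by move=> x y z; rewrite -[x]reprK -[y]reprK -[z]reprK !piE mulrDr.
Qed.

HB.instance Definition _ := GRing.Zmodule_isPzRing.Build Q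
  quotient_mulA quotient_mul1 quotient_mulr1 quotient_mulDl quotient_mulDr.

End QuotientRing.

Definition simple_module (S : pzRingType) (M : lmodType S) : Prop :=
  (exists m : M, m != 0) /\
  forall N : {pred M}, submod_closed N -> N =i pred1 0 \/ N =i predT.

Definition faithful_module (S : pzRingType) (M : lmodType S) : Prop :=
  forall a : S, (forall m : M, a *: m = 0) -> a = 0.

Definition left_primitive (S : pzRingType) : Prop :=
  exists M : lmodType S, simple_module M /\ faithful_module M.

(* Right S-modules are left modules over the converse ring S^c. *)
Definition primitive_ring (S : pzRingType) : Prop :=
  left_primitive S \/ left_primitive S^c.

Definition artinian_module (S : pzRingType) (M : lmodType S) : Prop :=
  forall N : nat -> {pred M},
    (forall n, submod_closed (N n)) ->
    (forall n, {subset N n.+1 <= N n}) ->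
  exists n0 : nat, forall n, (n0 <= n)%N -> N n =i N n0.

Definition left_artinian (S : pzRingType) : Prop := artinian_module S^o.

Definition right_artinian (S : pzRingType) : Prop := left_artinian S^c.

(* The two conditions agree on primitive rings; negating the conjunction makes
   "nonartinian" mean that at least one of them fails. *)
Definition artinian_ring (S : pzRingType) : Prop :=
  left_artinian S /\ right_artinian S.

Definition word_value (R : pzSemiRingType) (x y : R) (w : seq bool) : R :=
  \prod_(b <- w) (if b then x else y).

Definition contains_free_subsemigroup (R : pzSemiRingType) : Prop :=
  exists x y : R, forall v w : seq bool, v != [::] -> w != [::] ->
    word_value x y v = word_value x y w -> v = w.

(* Main.v *)
Require Import Defs.
From mathcomp Require Import all_boot all_order all_algebra.
From HB Require Import structures.
From mathcomp Require Import finfield boolp.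

(** A left primitive ring S that is not a division ring acts on a faithful simple
module M which has two vectors independent over the division ring of
S-endomorphisms of M, so by density some subring of S maps onto 2 by 2 matrices
over that division ring, whose centre contains k. Since a division ring is
artinian, a nonartinian left primitive subquotient is in this situation; the
right primitive case follows by passing to the converse ring. It then suffices to
find a free subsemigroup among the 2 by 2 matrices over k, because the freeness
of two elements is inherited by all their preimages.

The matrices used are those of the affine maps a |-> t a and a |-> t a + 1 of the
line. A product of n of them is a |-> t ^ n a + p(t), where p is the polynomial
of degree less than n whose 0-1 coefficients spell the word. Hence the two maps
are free as soon as words of equal length are told apart by the value of their
polynomial at t ([separates_words]); the length itself is then read off t ^ n.
In characteristic 0 one takes t = 2, by uniqueness of binary expansions; in
characteristic p one takes t transcendental over the prime field, which exists
because k is not algebraic over it ([exists_separating]).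

The case of density needed here is elementary. Let v1 be a nonzero vector of M.
If its annihilator is zero, then S is isomorphic to M as a module, so S has no
proper nonzero left ideal and is a division ring. Otherwise, by faithfulness, the
annihilator of v1 moves some vector v2, hence sends v2 anywhere in M by
simplicity; an element s that kills v1 and fixes v2 provides the projections
1 - s and s onto v1 and v2 ([simple_density2]). *)

Set Implicit Arguments.
Unset Strict Implicit.
Unset Printing Implicit Defensive.

Import GRing.Theory.
Local Open Scope ring_scope.
Local Open Scope quotient_scope.

(** * Scalars that separate binary words *)

Section Digits.

Variable k : fieldType.

Definition word_poly (w : seq bool) : {poly k} :=
  Poly [seq b%:R | b : bool <- w].

Lemma horner_word_poly_cons (t : k) b w :
  (word_poly (b :: w)).[t] = (word_poly w).[t] * t + b%:R.
Proof. by rewrite /word_poly /= horner_cons. Qed.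

Definition separates_words (t : k) : Prop :=
  forall v w : seq bool, size v = size w ->
    (word_poly v).[t] = (word_poly w).[t] -> v = w.

Lemma horner_word_poly_unit (t : k) n m :
  (word_poly (nseq n false ++ true :: nseq m false)).[t] = t ^+ n.
Proof.
elim: n => [|n IHn].
  rewrite expr0 horner_word_poly_cons.
  suff -> : (word_poly (nseq m false)).[t] = 0 by rewrite mul0r add0r.
  elim: m => [|m IHm]; first by rewrite /word_poly /= horner0.
  by rewrite horner_word_poly_cons IHm mul0r add0r.
by rewrite horner_word_poly_cons IHn addr0 exprSr.
Qed.

(** A power of t is the value of a word with a single nonzero digit, and
trailing zeros bring two such words to the same length. *)
Lemma separates_words_expI (t : k) :
  separates_words t -> injective (fun n : nat => t ^+ n).
Proof.
move=> sep n m /= eq_t.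
have index_true i j : index true (nseq i false ++ true :: nseq j false) = i.
  by rewrite index_cat mem_nseq andbF size_nseq /= addn0.
rewrite -[LHS](index_true n m) -[RHS](index_true m n); congr index; apply: sep.
  by rewrite !size_cat /= !size_nseq !addnS addnC.
by rewrite !horner_word_poly_unit.
Qed.

(** The value at 2 of a word is the number with these binary digits, and in
characteristic 0 distinct natural numbers stay distinct in k. *)
Lemma separates_words_char0 :
  (forall n : nat, n%:R = 0 :> k -> n = 0%N) -> separates_words 2%:R.
Proof.
move=> char0.
have natr_inj m n : (m%:R = n%:R :> k) -> m = n.
  wlog le_mn : m n / (m <= n)%N => [IH|eq_mn].
    by case/orP: (leq_total m n) => /IH // H /esym /H.
  apply/eqP; rewrite eqn_leq le_mn -subn_eq0.
  by rewrite (char0 (n - m)%N) // natrB // eq_mn subrr.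
pose binary := foldr (fun (b : bool) n => b + n.*2)%N 0%N.
have horner2 w : (word_poly w).[2%:R] = (binary w)%:R.
  elim: w => [|b w IHw]; first by rewrite /word_poly /= horner0.
  by rewrite horner_word_poly_cons IHw /= natrD -muln2 natrM addrC.
move=> v w sz; rewrite !horner2 => /natr_inj.
elim: v w sz => [|a v IHv] [|b w] //= [sz] eq_bin.
have eq_ab : a = b.
  by have := congr1 odd eq_bin; rewrite !oddD !odd_double !addbF !oddb.
move: eq_bin; rewrite eq_ab => /addnI /double_inj eq_bin.
by rewrite (IHv w).
Qed.

(** The difference of two word polynomials has coefficients in F, so it cannot
vanish at t unless the words agree digit by digit. *)
Lemma separates_words_transcendental (F : {pred k}) (t : k) :
  divring_closed F ->
  (forall p : {poly k}, p \is a polyOver F -> root p t -> p = 0) ->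
  separates_words t.
Proof.
move=> [F1 FB _] trF v w sz eq_t.
have F0 : 0 \in F by rewrite -(subrr 1) FB.
have F1or0 (b : bool) : b%:R \in F by case: b.
have coef_word u i : (word_poly u)`_i = (nth false u i)%:R.
  rewrite coef_Poly; case: (ltnP i (size u)) => [lt_iu|le_ui].
    by rewrite (nth_map false).
  by rewrite !nth_default // size_map.
have eq_poly : word_poly v - word_poly w = 0.
  apply: trF; last by rewrite rootE hornerD hornerN eq_t subrr.
  by apply/(all_nthP 0) => i _; rewrite coefB !coef_word; apply: FB.
apply: (eq_from_nth (x0 := false) sz) => i _.
have := congr1 (fun p : {poly k} => p`_i) eq_poly.
rewrite coefB coef0 !coef_word => /eqP; rewrite subr_eq0.
by case: (nth _ v i) (nth _ w i) => -[] //; rewrite ?(eq_sym 0) oner_eq0.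
Qed.

(** The prime field is the image of the canonical morphism from the integers
mod p, which makes its finiteness and its closure properties immediate. *)
Lemma exists_transcendental (p : nat) : p \in [pchar k] ->
  ~ algebraic_over_finite_subfield k ->
  exists (F : {pred k}) (t : k), divring_closed F /\
    forall q : {poly k}, q \is a polyOver F -> root q t -> q = 0.
Proof.
move=> chp not_alg; pose K := pPrimeCharType chp.
pose iota : {rmorphism 'F_p -> K} := in_alg K.
pose F : {pred K} := [pred x | x \in codom iota].
have closedF : divring_closed F.
  split=> [|_ _ /codomP[a ->] /codomP[b ->]|_ _ /codomP[a ->] /codomP[b ->]].
  - by apply/codomP; exists 1; rewrite rmorph1.
  - by apply/codomP; exists (a - b); rewrite rmorphB.
  - by apply/codomP; exists (a / b); rewrite fmorph_div.
exists F; apply: contrapT => no_t; apply: not_alg.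
exists F; split=> //; first by exists (codom iota).
move=> t; apply: contrapT => tr_t; apply: no_t.
exists t; split=> // q Fq q_t; apply/eqP/negPn/negP => q_neq0.
by apply: tr_t; exists q.
Qed.

Lemma exists_separating :
  ~ algebraic_over_finite_subfield k -> exists t : k, separates_words t.
Proof.
move=> not_alg; have [[p chp]|no_p] := pselect (exists p, p \in [pchar k]).
  have [F [t [closedF tr_t]]] := exists_transcendental chp not_alg.
  by exists t; apply: separates_words_transcendental tr_t.
exists 2%:R; apply: separates_words_char0 => n n0.
apply/eqP; rewrite -leqn0 leqNgt; apply/negP => n_gt0.
by apply: no_p; apply: (natf0_pchar n_gt0); rewrite n0.
Qed.

End Digits.

(** * Simple modules *)

Section SimpleModule.

Variables (S : pzRingType) (M : lmodType S).
Hypothesis simpleM : simple_module M.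

(** The orbit of v under a left ideal L is a submodule, hence all of M as soon as
it is nonzero. *)
Lemma simple_ideal_orbit (L : S -> Prop) (v : M) :
    (forall a x y, L x -> L y -> L (a * x + y)) ->
    (exists2 s, L s & s *: v != 0) ->
  forall m : M, exists2 s, L s & s *: v = m.
Proof.
move=> Llin [s Ls sv_neq0] m.
have L0 : L 0 by rewrite -(addNr s) -mulN1r; apply: Llin.
pose N : {pred M} := [pred x | `[< exists2 r, L r & r *: v = x >]].
have closedN : submod_closed N.
  split; first by apply/asboolP; exists 0; rewrite ?scale0r.
  move=> a _ _ /asboolP[x Lx <-] /asboolP[y Ly <-]; apply/asboolP.
  by exists (a * x + y); [apply: Llin | rewrite scalerDl scalerA].
case: (simpleM.2 N closedN) => eqN; last first.
  by have /asboolP : m \in N by rewrite eqN.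
have : s *: v \in N by apply/asboolP; exists s.
by rewrite eqN inE (negPf sv_neq0).
Qed.

(** If no nonzero element kills v, then a *: v generates M for each nonzero a,
and an element b that sends it back to v satisfies b * a = 1. *)
Lemma simple_left_inverse (v : M) : v != 0 ->
    (forall a : S, a *: v = 0 -> a = 0) ->
  forall a : S, a != 0 -> exists b, b * a = 1.
Proof.
move=> v_neq0 free_v a a_neq0.
have [||b _ bav] := @simple_ideal_orbit (fun=> True) (a *: v) _ _ v => //.
  exists 1 => //; rewrite scale1r.
  by apply: contraNneq a_neq0 => /free_v ->.
exists b; apply/subr0_eq/free_v.
by rewrite scalerBl scale1r -scalerA bav subrr.
Qed.

(** The annihilator of v1 is a left ideal that does not kill v2, so it sends v2
to any vector, in particular to v2 itself and to v1. *)
Lemma simple_density2 (v1 v2 : M) (a : S) :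
    a *: v1 = 0 -> a *: v2 != 0 ->
  exists f g : S, [/\ f *: v1 = 0, f *: v2 = v2, g *: v1 = 0 & g *: v2 = v1].
Proof.
move=> av1 av2.
have orbit : forall m, exists2 s, s *: v1 = 0 & s *: v2 = m.
  apply: simple_ideal_orbit; last by exists a.
  by move=> b x y xv1 yv1; rewrite scalerDl -scalerA xv1 yv1 scaler0 addr0.
have [[f fv1 fv2] [g gv1 gv2]] := (orbit v2, orbit v1).
by exists f, g.
Qed.

End SimpleModule.

(** A decreasing sequence of submodules, each 0 or M, either reaches 0 and stays
there or is constantly M. *)
Lemma simple_or_zero_artinian (S : pzRingType) (M : lmodType S) :
    (forall N : {pred M}, submod_closed N -> N =i pred1 0 \/ N =i predT) ->
  artinian_module M.
Proof.
move=> triv N closedN decrN.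
have decr n m : (n <= m)%N -> {subset N m <= N n}.
  move=> /subnK <-; elim: (m - n)%N => //= i IHi x.
  by rewrite addSn => /decrN /IHi.
have [[n Nn0]|no_zero] := pselect (exists n, N n =i pred1 0).
  exists n => m le_nm x; rewrite Nn0; apply/idP/idP => [/(decr _ _ le_nm)|].
    by rewrite Nn0.
  by rewrite inE => /eqP ->; have [] := closedN m.
have full n : N n =i predT.
  by case: (triv _ (closedN n)) => // Nn0; case: no_zero; exists n.
by exists 0%N => n _ x; rewrite !full.
Qed.

Lemma left_inverse_left_artinian (S : pzRingType) :
  (forall a : S, a != 0 -> exists b, b * a = 1) -> left_artinian S.
Proof.
move=> inv; apply: simple_or_zero_artinian => N [N0 Nlin].
have [[a Na a_neq0]|triv] := pselect (exists2 a, a \in N & a != 0).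
  right=> x; have [b ba1] := inv a a_neq0.
  have := Nlin (x * b) a 0 Na N0.
  by rewrite addr0 /GRing.scale /= -mulrA ba1 mulr1 => ->.
left=> x; rewrite inE; apply/idP/eqP => [Nx|-> //].
by apply/eqP/negPn/negP => x_neq0; apply: triv; exists x.
Qed.

(** Nonzero elements with left inverses have left inverses that are themselves
left invertible, so the inverses are two-sided and S has no right ideals either
besides 0 and S. *)
Lemma left_inverse_artinian (S : pzRingType) :
  (forall a : S, a != 0 -> exists b, b * a = 1) -> artinian_ring S.
Proof.
move=> inv; split; first exact: left_inverse_left_artinian.
suff inv_r : forall a : S, a != 0 -> exists b, a * b = 1.
  exact: (@left_inverse_left_artinian S^c).
move=> a a_neq0; have [b ba1] := inv a a_neq0; exists b.
have b_neq0 : b != 0.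
  apply: contra_neq a_neq0 => b0.
  by rewrite -[LHS]mul1r -ba1 b0 !mul0r.
have [c cb1] := inv b b_neq0.
have ca : c = a by rewrite -[c]mulr1 -ba1 mulrA cb1 mul1r.
by rewrite -[X in X * b]ca.
Qed.

Lemma artinian_ring_converse (S : pzRingType) :
  artinian_ring S^c -> artinian_ring S.
Proof. by case. Qed.

(** * Free subsemigroups *)

Section Affine.

Variables (k : fieldType) (S : pzRingType) (scalar : {rmorphism k -> S}).
Variables (M : lmodType S) (v1 v2 : M) (t : k) (x y : S).

Hypothesis scalarC : forall c s, scalar c * s = s * scalar c.
Hypothesis v1_neq0 : v1 != 0.
Hypotheses (xv1 : x *: v1 = scalar t *: v1) (xv2 : x *: v2 = v1 + v2).
Hypotheses (yv1 : y *: v1 = scalar t *: v1) (yv2 : y *: v2 = v2).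

(** A word acts as an affine map: on the direction v1 it multiplies by a power of
t, which depends only on the length, and it translates the point v2 by the value
at t of the polynomial of the word. *)
Lemma word_value_dir w :
  word_value x y w *: v1 = scalar (t ^+ size w) *: v1.
Proof.
rewrite /word_value; elim: w => [|b w IHw].
  by rewrite big_nil expr0 rmorph1.
rewrite big_cons -scalerA IHw scalerA -scalarC -scalerA.
have -> : (if b then x else y) *: v1 = scalar t *: v1 by case: b.
by rewrite scalerA -rmorphM -exprSr.
Qed.

Lemma word_value_point w :
  word_value x y w *: v2 = scalar (word_poly k w).[t] *: v1 + v2.
Proof.
rewrite /word_value; elim: w => [|b w IHw].
  by rewrite big_nil /word_poly /= horner0 rmorph0 scale0r add0r scale1r.
rewrite big_cons -scalerA IHw scalerDr scalerA -scalarC -scalerA.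
have -> : (if b then x else y) *: v1 = scalar t *: v1 by case: b.
have -> : (if b then x else y) *: v2 = scalar b%:R *: v1 + v2.
  by case: b; rewrite ?xv2 ?yv2 ?rmorph1 ?rmorph0 ?scale1r ?scale0r ?add0r.
by rewrite horner_word_poly_cons rmorphD rmorphM scalerA addrA scalerDl.
Qed.

Lemma scalar_line_inj : injective (fun c => scalar c *: v1).
Proof.
move=> c d /= /eqP; rewrite -subr_eq0 -scalerBl -rmorphB => /eqP cd0.
apply/eqP; rewrite -subr_eq0; apply: contraNT v1_neq0 => cd_neq0.
by rewrite -[v1]scale1r -(rmorph1 scalar) -(mulVf cd_neq0) rmorphM -scalerA
  cd0 scaler0.
Qed.

Lemma affine_free : separates_words t -> contains_free_subsemigroup S.
Proof.
move=> sep_t; exists x, y => v w _ _ eq_vw; apply: (sep_t v w).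
  apply: (separates_words_expI sep_t); apply: scalar_line_inj => /=.
  by rewrite -!word_value_dir eq_vw.
apply: scalar_line_inj; apply: (addIr v2) => /=.
by rewrite -!word_value_point eq_vw.
Qed.

End Affine.

(** The two generators act on the span of v1 and v2 as the matrices of
a |-> t a + 1 and a |-> t a in homogeneous coordinates. *)
Lemma left_primitive_free (k : fieldType) (S : pzRingType)
    (scalar : {rmorphism k -> S}) (t : k) :
    (forall c s, scalar c * s = s * scalar c) -> separates_words t ->
    left_primitive S -> ~ artinian_ring S ->
  contains_free_subsemigroup S.
Proof.
move=> scalarC sep_t [M [simpleM faithfulM]] not_art.
have [v1 v1_neq0] := simpleM.1.
have [free_v1|] := pselect (forall a : S, a *: v1 = 0 -> a = 0).
  case: not_art; apply: left_inverse_artinian.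
  exact: simple_left_inverse free_v1.
move=> /existsNP[a /not_implyP[av1 a_neq0]].
have [v2 av2] : exists v2 : M, a *: v2 != 0.
  apply: contrapT => av0; apply: a_neq0; apply: faithfulM => m.
  by apply/eqP/negPn/negP => am; apply: av0; exists m.
have [f [g [fv1 fv2 gv1 gv2]]] := simple_density2 simpleM av1 av2.
pose y := scalar t * (1 - f) + f.
have yv1 : y *: v1 = scalar t *: v1.
  by rewrite scalerDl -scalerA scalerBl scale1r fv1 subr0 addr0.
have yv2 : y *: v2 = v2.
  by rewrite scalerDl -scalerA scalerBl scale1r fv2 subrr scaler0 add0r.
apply: (@affine_free _ _ scalar M v1 v2 t (g + y) y) => //.
  by rewrite scalerDl gv1 add0r.
by rewrite scalerDl gv2 yv2.
Qed.

(** Passing to the converse ring reverses words. *)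
Lemma free_converse (S : pzRingType) :
  contains_free_subsemigroup S^c -> contains_free_subsemigroup S.
Proof.
move=> [x [y free_xy]]; exists x, y.
have word_rev (w : seq bool) :
    @word_value S^c x y (rev w) = @word_value S x y w.
  rewrite /word_value; elim: w => [|b w IHw]; first by rewrite !big_nil.
  by rewrite rev_cons big_rcons IHw big_cons.
move=> v w v_neq0 w_neq0 eq_vw; apply: (can_inj revK); apply: free_xy.
- by rewrite -size_eq0 size_rev size_eq0.
- by rewrite -size_eq0 size_rev size_eq0.
by rewrite !word_rev.
Qed.

(** A right primitive S is handled by applying the left case to the converse
ring, whose scalars are those of S because they are central. *)
Lemma primitive_free (k : fieldType) (S : pzRingType)
    (scalar : {rmorphism k -> S}) (t : k) :
    (forall c s, scalar c * s = s * scalar c) -> separates_words t ->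
    primitive_ring S -> ~ artinian_ring S ->
  contains_free_subsemigroup S.
Proof.
move=> scalarC sep_t [prim|prim] not_art.
  exact: (left_primitive_free scalarC sep_t).
pose scalarc : k -> S^c := scalar.
have scalarc_zmod : zmod_morphism scalarc by exact: (rmorphB scalar).
have scalarc_monoid : monoid_morphism scalarc.
  split=> [|a b]; first exact: (rmorph1 scalar).
  by rewrite /scalarc [a * b]mulrC (rmorphM scalar).
pose zm := GRing.isZmodMorphism.Build _ _ _ scalarc_zmod.
pose mm := GRing.isMonoidMorphism.Build _ _ _ scalarc_monoid.
pose scalar' : {rmorphism k -> S^c} := HB.pack scalarc zm mm.
apply: free_converse.
apply: (@left_primitive_free _ _ scalar' t) => // [c s|].
  exact: (esym (scalarC c s)).
by move=> /artinian_ring_converse.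
Qed.

(** Any lifts of free generators are free, since a relation between the lifts
would map to a relation between the generators. *)
Lemma free_subquotient (k : fieldType) (R : algType k) (A : subalgClosed R)
    (I : twoSidedIdeal (subalgebra A)) :
  contains_free_subsemigroup (quotient_ring I) -> contains_free_subsemigroup R.
Proof.
move=> [x [y free_xy]].
pose a := repr x; pose b := repr y.
exists (\val a), (\val b) => v w v_neq0 w_neq0.
have word_val u : word_value (\val a) (\val b) u = \val (word_value a b u).
  by rewrite rmorph_prod; apply: eq_bigr => -[].
have word_pi u : \pi_(quotient_ring I) (word_value a b u) = word_value x y u.
  rewrite /word_value; elim: u => [|c u IHu]; first by rewrite !big_nil !piE.
  have pi_gen : \pi_(quotient_ring I) (if c then a else b) = if c then x else y.
    by case: c; rewrite reprK.
  by rewrite !big_cons -IHu -pi_gen !piE.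
rewrite !word_val => /val_inj /(congr1 \pi_(quotient_ring I)).
by rewrite !word_pi; apply: free_xy.
Qed.

Theorem mainTheorem2 (k : fieldType)
    (k_not_alg : ~ algebraic_over_finite_subfield k)
    (R : algType k)
    (R_subquo : exists (A : subalgClosed R) (I : twoSidedIdeal (subalgebra A)),
       primitive_ring (quotient_ring I) /\ ~ artinian_ring (quotient_ring I)) :
  contains_free_subsemigroup R.
Proof.
have [t sep_t] := exists_separating k_not_alg.
case: R_subquo => A [I [prim not_art]]; apply: free_subquotient.
pose Q : pzRingType := quotient_ring I.
pose scalar (c : k) : Q := \pi_(quotient_ring I) c%:A.
have scalar_zmod : zmod_morphism scalar.
  by move=> a b; rewrite /scalar scalerBl !piE.
have scalar_monoid : monoid_morphism scalar.
  by split=> [|a b]; rewrite /scalar ?scale1r ?piE // -scalerA mulr_algl.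
pose zm := GRing.isZmodMorphism.Build _ _ _ scalar_zmod.
pose mm := GRing.isMonoidMorphism.Build _ _ _ scalar_monoid.
pose scalar' : {rmorphism k -> Q} := HB.pack scalar zm mm.
apply: (@primitive_free _ _ scalar' t) => // c s.
by rewrite -[s]reprK /= /scalar !piE mulr_algl mulr_algr.
Qed.
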